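(* Let $\alpha,\beta\in\mathbb{R}$ and $\eta\in\{1,-1\}$, and let $(G_4,g,J)$ be the connected, simply connected three-dimensional Lorentzian Lie group with product structure $J$ whose Lie algebra $\mathfrak{g}$ has a pseudo-orthonormal basis $\{e_1,e_2,e_3\}$ ($e_3$ timelike) with $[e_1,e_2]=-e_2+(2\eta-\beta)e_3$, $[e_1,e_3]=-\beta e_2+e_3$, $[e_2,e_3]=\alpha e_1$. Then $(G_4,g,J)$ is not a second kind algebraic Ricci soliton associated to the Kobayashi-Nomizu connection $\nabla^1$.
   Context: The left-invariant Lorentzian metric $g$ satisfies $g(e_1,e_1)=g(e_2,e_2)=1$, $g(e_3,e_3)=-1$, $g(e_i,e_j)=0$ for $i\ne j$. All tensors and connections are left-invariant and evaluated on $\mathfrak{g}$. $\nabla$ is the Levi-Civita connection of $g$. The product structure is $Je_1=e_1$, $Je_2=e_2$, $Je_3=-e_3$, and $(\nabla_XJ)Y=\nabla_X(JY)-J(\nabla_XY)$. The canonical connection is $\nabla^0_XY=\nabla_XY-\frac12(\nabla_XJ)(JY)$ and the Kobayashi-Nomizu connection is $\nabla^1_XY=\nabla^0_XY-\frac14[(\nabla_YJ)(JX)-(\nabla_{JY}J)X]$, with curvature $R^1(X,Y)Z=\nabla^1_X\nabla^1_YZ-\nabla^1_Y\nabla^1_XZ-\nabla^1_{[X,Y]}Z$. Its Ricci tensor is $\rho^1(X,Y)=-g(R^1(X,e_1)Y,e_1)-g(R^1(X,e_2)Y,e_2)+g(R^1(X,e_3)Y,e_3)$; its symmetrization is $\widetilde\rho^1(X,Y)=\frac12(\rho^1(X,Y)+\rho^1(Y,X))$,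 and the operator $\widetilde{\mathrm{Ric}}^1$ is defined by $\widetilde\rho^1(X,Y)=g(\widetilde{\mathrm{Ric}}^1(X),Y)$. Second kind algebraic Ricci soliton associated to $\nabla^1$ means: $\widetilde{\mathrm{Ric}}^1=c\,\mathrm{Id}+D$ for some real number $c$ and some derivation $D$ of $\mathfrak{g}$, i.e. a linear map with $D[X,Y]=[DX,Y]+[X,DY]$ for all $X,Y\in\mathfrak{g}$. *)

(* Defs.v *)
From mathcomp Require Import all_boot all_order all_algebra.
From mathcomp Require Import sesquilinear reals.

Set Implicit Arguments.
Unset Strict Implicit.
Unset Printing Implicit Defensive.

Import GRing.Theory.
Local Open Scope ring_scope.

(* Left-invariant tensors and connections on a connected, simply connected Lie
   group are encoded by their values on the Lie algebra V; in particular a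
   left-invariant connection is a bilinear map V -> V -> V. *)

Section LieAlgebra.
Context {R : realType} {V : vectType R}.
Implicit Types (br nabla : V -> V -> V) (g : V -> V -> R) (J : V -> V).

Definition is_lie_bracket br : Prop :=
  (forall X, br X X = 0) /\
  (forall X Y Z, br X (br Y Z) + br Y (br Z X) + br Z (br X Y) = 0).

Definition is_derivation br (D : V -> V) : Prop :=
  forall X Y, D (br X Y) = br (D X) Y + br X (D Y).

Definition torsion_free br nabla : Prop :=
  forall X Y, nabla X Y - nabla Y X = br X Y.

(* The term X (g (Y, Z)) vanishes since g (Y, Z) is constant for left-invariant
   Y and Z. *)
Definition metric_compatible g nabla : Prop :=
  forall X Y Z, g (nabla X Y) Z + g Y (nabla X Z) = 0.

Definition is_levi_civita br g nabla : Prop :=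
  torsion_free br nabla /\ metric_compatible g nabla.

(* nablaJ nabla J X Y is (nabla_X J) Y *)
Definition nablaJ nabla J (X Y : V) : V := nabla X (J Y) - J (nabla X Y).

Definition canonical_connection nabla J (X Y : V) : V :=
  nabla X Y - 2^-1 *: nablaJ nabla J X (J Y).

Definition kobayashi_nomizu nabla J (X Y : V) : V :=
  canonical_connection nabla J X Y
  - 4^-1 *: (nablaJ nabla J Y (J X) - nablaJ nabla J (J Y) X).

Definition curvature br nabla (X Y Z : V) : V :=
  nabla X (nabla Y Z) - nabla Y (nabla X Z) - nabla (br X Y) Z.

Definition pseudo_orthonormal g (e1 e2 e3 : V) : Prop :=
  [/\ basis_of fullv [:: e1; e2; e3],
      [/\ g e1 e1 = 1, g e2 e2 = 1 & g e3 e3 = -1] &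
      [/\ g e1 e2 = 0, g e1 e3 = 0 & g e2 e3 = 0]].

Definition ricci br g nabla (e1 e2 e3 X Y : V) : R :=
  - g (curvature br nabla X e1 Y) e1 - g (curvature br nabla X e2 Y) e2
  + g (curvature br nabla X e3 Y) e3.

Definition sym_ricci br g nabla (e1 e2 e3 X Y : V) : R :=
  2^-1 * (ricci br g nabla e1 e2 e3 X Y + ricci br g nabla e1 e2 e3 Y X).

Definition is_sym_ricci_operator br g nabla (e1 e2 e3 : V) (Ric : 'End(V)) :
    Prop :=
  forall X Y, sym_ricci br g nabla e1 e2 e3 X Y = g (Ric X) Y.

(* Ric is unique, as g is nondegenerate, and exists, as sym_ricci is bilinear
   for bilinear br and nabla. *)
Definition second_kind_algebraic_ricci_soliton br g nabla (e1 e2 e3 : V) :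
    Prop :=
  exists Ric : 'End(V), is_sym_ricci_operator br g nabla e1 e2 e3 Ric /\
  exists (c : R) (D : 'End(V)), is_derivation br D /\ Ric = c *: \1%VF + D.

End LieAlgebra.

(* Main.v *)
(* On vectors X = x1 e1 + x2 e2 + x3 e3, the Koszul formula and then the
   Kobayashi-Nomizu connection, its curvature and its symmetrized Ricci operator
   all have closed polynomial coordinate formulas. With n = eta, d = beta - n,
   p = -d^2, q = (2 n - beta) alpha - 1 and r = alpha / 2, the operator is
   e1 |-> p e1, e2 |-> q e2 - r e3, e3 |-> r e2. Requiring Ric - c Id to be a
   derivation on [e1, e2] and [e1, e3] and eliminating c leaves
   d alpha = n d - 1 and then d^2 = 0, which are incompatible. *)
Require Import Defs.
From mathcomp Require Import all_boot all_order all_algebra.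
From mathcomp Require Import sesquilinear reals ring lra.

Local Open Scope ring_scope.
Import GRing.Theory Num.Theory.

(** * Coordinates in a pseudo-orthonormal frame, and the Koszul formula *)

Section Frame.
Context {R : realType} {V : vectType R} (e1 e2 e3 : V).

(** Normal form for vectors: once both sides are a [comb], an identity of vectors splits into three
    polynomial identities. *)
Definition comb (x y z : R) : V := x *: e1 + y *: e2 + z *: e3.

Lemma combD x y z x' y' z' :
  comb x y z + comb x' y' z' = comb (x + x') (y + y') (z + z').
Proof. by rewrite /comb !scalerDl [LHS]addrACA [X in X + _]addrACA. Qed.

Lemma combZ a x y z : a *: comb x y z = comb (a * x) (a * y) (a * z).
Proof. by rewrite /comb !scalerDr !scalerA. Qed.

Lemma combN x y z : - comb x y z = comb (- x) (- y) (- z).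
Proof. by rewrite -scaleN1r combZ !mulN1r. Qed.

Lemma comb1 : e1 = comb 1 0 0.
Proof. by rewrite /comb !scale0r !addr0 scale1r. Qed.

Lemma comb2 : e2 = comb 0 1 0.
Proof. by rewrite /comb !scale0r addr0 add0r scale1r. Qed.

Lemma comb3 : e3 = comb 0 0 1.
Proof. by rewrite /comb !scale0r !add0r scale1r. Qed.

Lemma comb_linear (f : {linear V -> V}) x y z :
  f (comb x y z) = x *: f e1 + y *: f e2 + z *: f e3.
Proof. by rewrite /comb !linearD !linearZ. Qed.

Lemma comb_bilinear (f : {bilinear V -> V -> V}) x y z x' y' z' :
  f (comb x y z) (comb x' y' z') =
    x *: (x' *: f e1 e1 + y' *: f e1 e2 + z' *: f e1 e3) +
    y *: (x' *: f e2 e1 + y' *: f e2 e2 + z' *: f e2 e3) +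
    z *: (x' *: f e3 e1 + y' *: f e3 e2 + z' *: f e3 e3).
Proof. by rewrite {1}/comb !linearDl !linearZl_LR /= !comb_linear. Qed.

Context (g : {symmetric V}) (he : pseudo_orthonormal g e1 e2 e3).

Lemma symmetric_formC X Y : g X Y = g Y X.
Proof. by rewrite hermC expr0 mul1r. Qed.

Lemma form_comb x y z x' y' z' :
  g (comb x y z) (comb x' y' z') = x * x' + y * y' - z * z'.
Proof.
case: he => _ [g11 g22 g33] [g12 g13 g23].
have g21 : g e2 e1 = 0 by rewrite symmetric_formC.
have g31 : g e3 e1 = 0 by rewrite symmetric_formC.
have g32 : g e3 e2 = 0 by rewrite symmetric_formC.
rewrite /comb !linearDl !linearDr /= !linearZl_LR /= !linearZr_LR /=.
rewrite g11 g22 g33 g12 g13 g23 g21 g31 g32; ring.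
Qed.

Lemma form_comb1 x y z : g (comb x y z) e1 = x.
Proof. by rewrite [X in g _ X]comb1 form_comb; ring. Qed.

Lemma form_comb2 x y z : g (comb x y z) e2 = y.
Proof. by rewrite [X in g _ X]comb2 form_comb; ring. Qed.

Lemma form_comb3 x y z : g (comb x y z) e3 = - z.
Proof. by rewrite [X in g _ X]comb3 form_comb; ring. Qed.

(** The last sign compensates for [g e3 e3 = -1]. This recovers a vector from its pairings with the
    frame, which is what Koszul and the Ricci form provide. *)
Lemma comb_form X : X = comb (g X e1) (g X e2) (- g X e3).
Proof.
case: (he) => /andP[/eqP Ve _] _ _.
have: X \in <<[:: e1; e2; e3]>>%VS by rewrite Ve memvf.
rewrite !span_cons span_nil addv0.
case/memv_addP => _ /vlineP[x ->] [u /memv_addP[_ /vlineP[y ->]]].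
case=> _ /vlineP[z ->] -> ->; rewrite addrA -/(comb x y z).
by rewrite form_comb1 form_comb2 form_comb3 opprK.
Qed.

Lemma comb_inj x y z x' y' z' :
  comb x y z = comb x' y' z' -> [/\ x = x', y = y' & z = z'].
Proof.
move=> eq_comb; split.
- by rewrite -(form_comb1 x y z) eq_comb form_comb1.
- by rewrite -(form_comb2 x y z) eq_comb form_comb2.
- by apply: oppr_inj; rewrite -(form_comb3 x y z) eq_comb form_comb3.
Qed.

Context (br nabla : {bilinear V -> V -> V}) (hbr : forall X, br X X = 0).

Lemma bracketC X Y : br Y X = - br X Y.
Proof.
apply/eqP; rewrite -addr_eq0; apply/eqP.
by have := hbr (X + Y); rewrite linearDl !linearD /= !hbr add0r addr0 addrC.
Qed.

(** Brackets become differences of [nabla] by torsion-freeness; metric compatibility at the three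
    cyclic permutations of X, Y, Z then eliminates all but one term. *)
Lemma koszul (hnabla : is_levi_civita br g nabla) X Y Z :
  g (nabla X Y) Z =
    2^-1 * (g (br X Y) Z - g (br Y Z) X + g (br Z X) Y).
Proof.
case: hnabla => torsion metric.
rewrite -!torsion !linearBl /=.
have := (metric X Y Z, metric Y Z X, metric Z X Y).
rewrite !(symmetric_formC _ (nabla _ _)) => -[[]].
lra.
Qed.

End Frame.

Arguments form_comb {R V e1 e2 e3 g} he.
Arguments form_comb1 {R V e1 e2 e3 g} he.
Arguments form_comb2 {R V e1 e2 e3 g} he.
Arguments form_comb3 {R V e1 e2 e3 g} he.
Arguments comb_form {R V e1 e2 e3 g} he.
Arguments comb_inj {R V e1 e2 e3 g} he {x y z x' y' z'}.
Arguments bracketC {R V br} hbr.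
Arguments koszul {R V g br nabla} hnabla.

(** * Connections, curvature and Ricci operator in coordinates *)

Section G4.
Context {R : realType} {V : vectType R} (alpha beta eta : R).
Context (br : {bilinear V -> V -> V}) (hbr : is_lie_bracket br).
Context (g : {symmetric V}) (e1 e2 e3 : V) (he : pseudo_orthonormal g e1 e2 e3).
Context (h12 : br e1 e2 = - e2 + (2 * eta - beta) *: e3).
Context (h13 : br e1 e3 = - (beta *: e2) + e3).
Context (h23 : br e2 e3 = alpha *: e1).
Context (J : 'End(V)) (hJ : [/\ J e1 = e1, J e2 = e2 & J e3 = - e3]).
Context (nabla : {bilinear V -> V -> V}) (hnabla : is_levi_civita br g nabla).

Local Notation comb := (comb e1 e2 e3).
Local Notation nabla1 := (kobayashi_nomizu nabla J).

Lemma bracket_comb x y z x' y' z' :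
  br (comb x y z) (comb x' y' z') =
    comb (alpha * (y * z' - z * y'))
         (- (x * y' - y * x') - beta * (x * z' - z * x'))
         ((2 * eta - beta) * (x * y' - y * x') + (x * z' - z * x')).
Proof.
have [brXX _] := hbr.
rewrite comb_bilinear !brXX (bracketC brXX e1 e2) (bracketC brXX e1 e3).
rewrite (bracketC brXX e2 e3).
have -> : br e1 e2 = comb 0 (- 1) (2 * eta - beta).
  by rewrite h12 /comb scale0r add0r scaleN1r.
have -> : br e1 e3 = comb 0 (- beta) 1.
  by rewrite h13 /comb scale0r add0r scaleNr scale1r.
have -> : br e2 e3 = comb alpha 0 0.
  by rewrite h23 /comb !scale0r !addr0.
rewrite !scaler0 !(addr0, add0r) !(combN, combZ, combD).
by congr (comb _ _ _); ring.
Qed.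

Lemma nabla_comb x y z x' y' z' :
  nabla (comb x y z) (comb x' y' z') =
    comb (- (y * y') + (2^-1 * alpha - eta) * (y * z')
            - (2^-1 * alpha + eta) * (z * y') - z * z')
         ((eta - beta + 2^-1 * alpha) * (x * z') + y * x'
            + (2^-1 * alpha + eta) * (z * x'))
         ((eta - beta + 2^-1 * alpha) * (x * y')
            + (2^-1 * alpha - eta) * (y * x') - z * x').
Proof.
have [brXX _] := hbr.
have br_e1 u v w : br e1 (comb u v w) =
    comb 0 (- v - beta * w) ((2 * eta - beta) * v + w).
  by rewrite [X in br X _](comb1 e1 e2 e3) bracket_comb; congr (comb _ _ _); ring.
have br_e2 u v w : br e2 (comb u v w) =
    comb (alpha * w) u (- (2 * eta - beta) * u).
  by rewrite [X in br X _](comb2 e1 e2 e3) bracket_comb; congr (comb _ _ _); ring.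
have br_e3 u v w : br e3 (comb u v w) = comb (- alpha * v) (beta * u) (- u).
  by rewrite [X in br X _](comb3 e1 e2 e3) bracket_comb; congr (comb _ _ _); ring.
rewrite [LHS](comb_form he) !(koszul hnabla).
(* Moves each frame vector to the first slot, where [br_e1], [br_e2] and [br_e3] apply. *)
rewrite !(bracketC brXX e1) !(bracketC brXX e2) !(bracketC brXX e3).
rewrite bracket_comb !(br_e1, br_e2, br_e3) !combN.
rewrite !(form_comb he, form_comb1 he, form_comb2 he, form_comb3 he).
by congr (comb _ _ _); field.
Qed.

Lemma J_comb x y z : J (comb x y z) = comb x y (- z).
Proof.
have [J1 J2 J3] := hJ.
by rewrite comb_linear /= J1 J2 J3 scalerN -scaleNr.
Qed.

(** The result commutes with [J]: it preserves the plane of e1, e2 and the line of e3. Its mixed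
    terms are the projections of brackets onto these eigenspaces, so [eta] cancels. *)
Lemma kobayashi_nomizu_comb x y z x' y' z' :
  nabla1 (comb x y z) (comb x' y' z') =
    comb (- (y * y') - alpha * (z * y')) (y * x' + beta * (z * x')) (x * z').
Proof.
rewrite /kobayashi_nomizu /canonical_connection /nablaJ.
rewrite !(J_comb, nabla_comb) !(combN, combD, combZ).
by congr (comb _ _ _); field.
Qed.

(** By skew-symmetry the first two arguments enter only through the coordinates [b12], [b13], [b23]
    of their wedge product. *)
Lemma curvature_comb x y z x' y' z' x'' y'' z'' :
  let b12 := x * y' - y * x' in
  let b13 := x * z' - z * x' in
  let b23 := y * z' - z * y' in
  curvature br nabla1 (comb x y z) (comb x' y' z') (comb x'' y'' z'') =
    comb (((2 * eta - beta) * alpha - 1) * b12 * y''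
            + (alpha - beta) * (b13 * y'' + b23 * x''))
         ((1 - (2 * eta - beta) * beta) * b12 * x'' + (beta - alpha) * b23 * y'')
         (- alpha * b23 * z'').
Proof.
rewrite /curvature bracket_comb !kobayashi_nomizu_comb !(combN, combD) /=.
by congr (comb _ _ _); ring.
Qed.

(** The term [alpha * y * z'] has no transpose; symmetrization spreads it over both mixed entries,
    whence the later factor [2^-1 * alpha]. *)
Lemma ricci_comb x y z x' y' z' :
  ricci br g nabla1 e1 e2 e3 (comb x y z) (comb x' y' z') =
    ((2 * eta - beta) * beta - 1) * x * x'
    + ((2 * eta - beta) * alpha - 1) * y * y' + alpha * y * z'.
Proof.
rewrite /ricci.
have R1 := curvature_comb x y z 1 0 0 x' y' z'; rewrite -comb1 in R1.
have R2 := curvature_comb x y z 0 1 0 x' y' z'; rewrite -comb2 in R2.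
have R3 := curvature_comb x y z 0 0 1 x' y' z'; rewrite -comb3 in R3.
by rewrite R1 R2 R3 (form_comb1 he) (form_comb2 he) (form_comb3 he); ring.
Qed.

Lemma sym_ricci_comb x y z x' y' z' :
  sym_ricci br g nabla1 e1 e2 e3 (comb x y z) (comb x' y' z') =
    ((2 * eta - beta) * beta - 1) * (x * x')
    + ((2 * eta - beta) * alpha - 1) * (y * y')
    + 2^-1 * alpha * (y * z' + z * y').
Proof. by rewrite /sym_ricci !ricci_comb; field. Qed.

Lemma sym_ricci_operator_comb (Ric : 'End(V))
    (hRic : is_sym_ricci_operator br g nabla1 e1 e2 e3 Ric) x y z :
  Ric (comb x y z) =
    comb (((2 * eta - beta) * beta - 1) * x)
         (((2 * eta - beta) * alpha - 1) * y + 2^-1 * alpha * z)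
         (- (2^-1 * alpha * y)).
Proof.
rewrite [LHS](comb_form he) -!hRic.
have S1 := sym_ricci_comb x y z 1 0 0; rewrite -comb1 in S1.
have S2 := sym_ricci_comb x y z 0 1 0; rewrite -comb2 in S2.
have S3 := sym_ricci_comb x y z 0 0 1; rewrite -comb3 in S3.
by rewrite S1 S2 S3; congr (comb _ _ _); ring.
Qed.

(** The first two equations are the e2 and e3 components of the derivation identity on [e1, e2]; the
    third is the e2 component on [e1, e3]. *)
Lemma soliton_equations (heta : eta ^+ 2 = 1) :
  second_kind_algebraic_ricci_soliton br g nabla1 e1 e2 e3 ->
  let p := - (beta - eta) ^+ 2 in
  let q := (2 * eta - beta) * alpha - 1 in
  exists c : R,
    [/\ c = p + (eta - beta) * alpha,
        alpha = (2 * eta - beta) * (p + q - c) &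
        alpha = beta * (q - p + c)].
Proof.
case=> Ric [/sym_ricci_operator_comb RicE [c [D [derD RicD]]]] p q; exists c.
have DE x y z : D (comb x y z) =
    Ric (comb x y z) + comb (- c * x) (- c * y) (- c * z).
  have -> : comb (- c * x) (- c * y) (- c * z) = - (c *: comb x y z).
    by rewrite combZ combN !mulNr.
  by rewrite RicD add_lfunE scale_lfunE id_lfunE addrAC subrr add0r.
(* Writing 1 as [eta ^+ 2] completes the square. *)
have pE : (2 * eta - beta) * beta - 1 = p by rewrite /p; lra.
have := derD (comb 1 0 0) (comb 0 1 0).
have := derD (comb 1 0 0) (comb 0 0 1).
rewrite !(bracket_comb, DE, RicE, combD) -/q pE.
move=> /(comb_inj he)[_ eq13 _] /(comb_inj he)[_ eq12_2 eq12_3].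
by split; lra.
Qed.

End G4.

Lemma soliton_equations_inconsistent (R : realFieldType) (alpha beta eta c : R)
    (heta : eta = 1 \/ eta = -1)
    (p := - (beta - eta) ^+ 2) (q := (2 * eta - beta) * alpha - 1) :
  c = p + (eta - beta) * alpha ->
  alpha = (2 * eta - beta) * (p + q - c) ->
  alpha = beta * (q - p + c) -> False.
Proof.
rewrite {}/p {}/q.
(* After this shift [p + q - c] is [eta * alpha - 1] and [q - p + c] is
   [(eta - 2 * d) * alpha - 1]. *)
have [d ->] : exists d, beta = eta + d
  by exists (beta - eta); rewrite addrC subrK.
move=> -> eq2 eq3.
(* Since [eta] squares to 1, the pure [alpha] terms of [eq2] cancel. *)
have dalpha : d * alpha = eta * d - 1.
  by move: eq2; case: heta => ->; lra.
(* Supplied separately because [lra] is linear in monomials; with [dalpha] it turns [eq3] into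
   [2 * eta * d ^+ 2 = 0]. *)
have ddalpha : d * d * alpha = d * (eta * d - 1) by rewrite -mulrA dalpha.
have /eqP : d ^+ 2 = 0.
  by move: dalpha ddalpha eq3; case: heta => ->; lra.
(* At d = 0, [dalpha] reads 0 = -1. *)
by rewrite expf_eq0 /= => /eqP d0; move: dalpha; rewrite d0; lra.
Qed.

Theorem theorem2p39 (R : realType) (alpha beta eta : R)
    (heta : eta = 1 \/ eta = -1)
    (V : vectType R) (br : {bilinear V -> V -> V}) (hbr : is_lie_bracket br)
    (g : {symmetric V}) (e1 e2 e3 : V) (he : pseudo_orthonormal g e1 e2 e3)
    (h12 : br e1 e2 = - e2 + (2 * eta - beta) *: e3)
    (h13 : br e1 e3 = - (beta *: e2) + e3)
    (h23 : br e2 e3 = alpha *: e1)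
    (J : 'End(V)) (hJ : [/\ J e1 = e1, J e2 = e2 & J e3 = - e3])
    (nabla : {bilinear V -> V -> V}) (hnabla : is_levi_civita br g nabla) :
  ~ second_kind_algebraic_ricci_soliton br g (kobayashi_nomizu nabla J)
      e1 e2 e3.
Proof.
have eta2 : eta ^+ 2 = 1 by case: heta => ->; rewrite ?sqrrN expr1n.
move=> /(soliton_equations alpha beta eta br hbr g e1 e2 e3 he h12 h13 h23 J hJ
  nabla hnabla eta2)[c [c_eq eq12 eq13]].
exact: (soliton_equations_inconsistent _ alpha beta eta c heta c_eq eq12 eq13).
Qed.
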